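(* Fix $\alpha\in(0,1)$. In the classical case $\operatorname{rank}(X)=p\le n$, with all submodels allowed and known variance, the PoSI constant satisfies $$\limsup_{p\to\infty}\ \sup_{X_{n\times p}}\ \frac{K(X_{n\times p},\mathcal M_{\mathrm{all}},\alpha)}{\sqrt p}\ \le\ \frac{\sqrt3}{2},$$ where for each $p$ the supremum is over all $n\ge p$ and all real $n\times p$ matrices $X_{n\times p}$ of rank $p$.
   Context: PoSI constant for known variance ($\sigma=1$, $r=\infty$). Let $X=(X_1,\dots,X_p)$ be a real $n\times p$ matrix of rank $p$; then $\mathcal M_{\mathrm{all}}$ is the set of all nonempty subsets of $\{1,\dots,p\}$. For $M\in\mathcal M_{\mathrm{all}}$ and $j\in M$, $X_{j\cdot M}$ is the residual vector of $X_j$ after orthogonal projection onto the span of $\{X_k:k\in M\setminus\{j\}\}$ (equal to $X_j$ if $M=\{j\}$), and $\bar l_{j\cdot M}=X_{j\cdot M}/\|X_{j\cdot M}\|$. With $\varepsilon\sim N(0,I_n)$, $K(X,\mathcal M_{\mathrm{all}},\alpha)$ is the minimal $K$ such that $$P\Bigl[\max_{M\in\mathcal M_{\mathrm{all}}}\max_{j\in M}|\bar l_{j\cdot M}^T\varepsilon|\le K\Bigr]\ge1-\alpha .$$ *)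

(* Defs.v *)
From HB Require Import structures.
From mathcomp Require Import all_boot all_order all_algebra.
From mathcomp Require Import all_classical all_reals all_analysis.
From mathcomp Require Import measurable_realfun.

Set Implicit Arguments.
Unset Strict Implicit.
Unset Printing Implicit Defensive.

Import Order.TTheory GRing.Theory Num.Theory.
Import numFieldNormedType.Exports.

Local Open Scope classical_set_scope.
Local Open Scope ring_scope.

Section StandardGaussian.
Variable R : realType.

Definition tcons n (x : measurableTypeR R * n.-tuple (measurableTypeR R)) :
  n.+1.-tuple (measurableTypeR R) := [tuple of x.1 :: x.2].

Lemma measurable_tcons n : measurable_fun [set: _] (@tcons n).
Proof. exact: measurable_cons. Qed.

HB.instance Definition _ n :=
  isMeasurableFun.Build _ _ _ _ (@tcons n) (@measurable_tcons n).

(* N(0, I_n), as the n-fold product of the law N(0, 1). *)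
Fixpoint std_gaussian n : probability (n.-tuple (measurableTypeR R)) R :=
  match n with
  | 0 => \d_([tuple] : 0.-tuple (measurableTypeR R))
  | m.+1 => distribution (normal_prob 0 1 \x std_gaussian m)%E (@tcons m)
  end.

End StandardGaussian.

Section PoSI.
Variable R : realType.

Definition l2norm n (v : 'rV[R]_n) : R := Num.sqrt (\sum_i v 0 i ^+ 2).

(* The row space of [kermx U^T] is the orthogonal complement of that of [U]. *)
Definition orth_proj n (U : 'M[R]_n) : 'M[R]_n := proj_mx <<U>>%MS (kermx U^T).

Lemma orth_capmx n (U : 'M[R]_n) : (<<U>> :&: kermx U^T)%MS = 0.
Proof.
apply/eqP; rewrite -submx0; apply/row_subP => i.
set v := row i _.
have vc : (v <= <<U>> :&: kermx U^T)%MS by exact: row_sub.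
move: vc; rewrite sub_capmx genmxE => /andP[/submxP[w vE] /sub_kermxP vU].
have : v *m v^T = 0 by rewrite {2}vE trmx_mul mulmxA vU mul0mx.
move=> /matrixP /(_ 0 0); rewrite !mxE => h.
suff -> : v = 0 by exact: sub0mx.
apply/rowP => k; rewrite [RHS]mxE; apply/eqP.
have /eqP := h; rewrite psumr_eq0; last first.
  by move=> l _; rewrite [v^T _ _]mxE -expr2 sqr_ge0.
by move=> /allP /(_ k (mem_index_enum _)); rewrite [v^T _ _]mxE mulf_eq0 orbb.
Qed.

Lemma orth_projP n (U : 'M[R]_n) (v : 'rV[R]_n) :
  (v *m orth_proj U <= U)%MS /\ (v - v *m orth_proj U) *m U^T = 0.
Proof.
split; first by rewrite -(genmxE U) proj_mx_sub.
apply/sub_kermxP; apply: proj_mx_compl_sub.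
apply: submx_full; rewrite -col_leq_rank.
have := mxrank_sum_cap <<U>>%MS (kermx U^T).
rewrite orth_capmx mxrank0 addn0 => ->.
by rewrite mxrank_gen mxrank_ker mxrank_tr subnKC // rank_leq_col.
Qed.

Lemma measurable_bigmax d (T : measurableType d) (I : Type) (s : seq I) (P : pred I)
    (h : I -> T -> R) :
  (forall i, measurable_fun setT (h i)) ->
  measurable_fun setT (fun x => \big[Num.max/0]_(i <- s | P i) h i x).
Proof.
move=> mh; elim: s => [|i s ih].
  by under eq_fun do rewrite big_nil; exact: measurable_cst.
under eq_fun do rewrite big_cons.
by case: (P i) => //; exact: (measurable_realfun.measurable_maxr (mh i) ih).
Qed.

Section Design.
Variables (n p : nat) (X : 'M[R]_(n, p)).

(* Vectors of R^n are rows here, so that spans are row spaces. *)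
Definition regressor (j : 'I_p) : 'rV[R]_n := (col j X)^T.

Definition span_of (M : {set 'I_p}) : 'M[R]_n :=
  (\sum_(k in M) <<regressor k>>)%MS.

Definition adjusted (M : {set 'I_p}) (j : 'I_p) : 'rV[R]_n :=
  regressor j - regressor j *m orth_proj (span_of (M :\ j)%SET).

Lemma adjustedP (M : {set 'I_p}) (j : 'I_p) :
  (regressor j - adjusted M j <= span_of (M :\ j)%SET)%MS /\
  (forall k, k \in (M :\ j)%SET -> adjusted M j *m (regressor k)^T = 0).
Proof.
have [h1 h2] := orth_projP (span_of (M :\ j)%SET) (regressor j).
split; first by rewrite /adjusted opprB addrC subrK.
move=> k kM; have : (regressor k <= span_of (M :\ j)%SET)%MS.
  by apply: (sumsmx_sup k) => //; rewrite genmxE.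
by case/submxP => w ->; rewrite trmx_mul mulmxA h2 mul0mx.
Qed.

Definition unit_adjusted (M : {set 'I_p}) (j : 'I_p) : 'rV[R]_n :=
  (l2norm (adjusted M j))^-1 *: adjusted M j.

(* The default value 0 is harmless as all the terms are nonnegative. *)
Definition max_stat (MM : {set {set 'I_p}})
    (e : n.-tuple (measurableTypeR R)) : R :=
  \big[Num.max/0]_(M in MM) \big[Num.max/0]_(j in M)
    `|\sum_(i < n) unit_adjusted M j 0 i * tnth e i|.

Lemma measurable_max_stat (MM : {set {set 'I_p}}) :
  measurable_fun setT (max_stat MM).
Proof.
apply: measurable_bigmax => M; apply: measurable_bigmax => j.
apply: measurableT_comp => //; apply: measurable_sum => i.
by apply: measurable_funM => //; exact: measurable_tnth.
Qed.

HB.instance Definition _ MM :=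
  isMeasurableFun.Build _ _ _ _ (max_stat MM) (measurable_max_stat MM).

(* The infimum is attained, see [PoSI_constP]. *)
Definition PoSI_const (MM : {set {set 'I_p}}) (alpha : R) : R :=
  inf [set K : R | ((1 - alpha)%:E <=
                    std_gaussian R n [set e | (max_stat MM e <= K)%R])%E].

Lemma PoSI_constP (MM : {set {set 'I_p}}) (alpha : R) : 0 < alpha < 1 ->
  let coverage K := std_gaussian R n [set e | max_stat MM e <= K] in
  ((1 - alpha)%:E <= coverage (PoSI_const MM alpha))%E /\
  (forall K, ((1 - alpha)%:E <= coverage K)%E -> PoSI_const MM alpha <= K).
Proof.
move=> /andP[a0 a1] coverage; rewrite /PoSI_const -/(coverage _).
set S := [set K : R | _].
have covE K : coverage K = cdf (max_stat MM : {RV (std_gaussian R n) >-> R}) K.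
  by rewrite /cdf /distribution /pushforward /coverage; congr (std_gaussian R n _);
    apply/funext => e; rewrite /preimage /mkset in_itv.
have S0 K : S K -> 0 <= K.
  rewrite /S /= => SK; case: (leP 0 K) => // K0; move: SK.
  rewrite (_ : [set e | _] = classical_sets.set0).
    by rewrite measure0 lee_fin subr_le0 leNgt a1.
  apply/seteqP; split => e //=; apply/negP; rewrite -ltNge.
  apply: (lt_le_trans K0); rewrite /max_stat.
  elim/big_ind: _ => // [x y x0 y0|M _]; first by rewrite le_max x0.
  by elim/big_ind: _ => // x y x0 y0; rewrite le_max x0.
have Sne : S !=set0.
  apply: contrapT => /forallNP Sn.
  have : (1 <= (1 - alpha)%:E :> \bar R)%E.
    apply: (cvge_to_le (cvg_cdfy1 (max_stat MM : {RV (std_gaussian R n) >-> R}))).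
    near=> K; rewrite -covE; apply/ltW; rewrite ltNge; apply/negP; exact: Sn.
  by rewrite lee_fin leNgt ltrBlDr ltrDl a0.
have Slb : has_lbound S by exists 0 => K /S0.
split; last by move=> K SK; exact: ge_inf.
rewrite covE.
have := cdf_right_continuous
  (X := (max_stat MM : {RV (std_gaussian R n) >-> R})) (x := inf S).
move=> /cvge_to_ge; apply.
near=> K; rewrite -covE.
have KS : inf S < K by near: K; exact: nbhs_right_gt.
have [K' SK' K'K] := inf_lt Sne KS.
apply: (le_trans SK'); rewrite -/(coverage _) !covE.
by apply: cdf_nondecreasing; exact: ltW.
Unshelve. all: by end_near. Qed.

End Design.

Definition all_submodels p : {set {set 'I_p}} := [set M | M != finset.set0]%SET.

End PoSI.

(* Main.v *)
Require Import Defs.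
From mathcomp Require Import all_boot all_order all_algebra.
From mathcomp Require Import all_classical all_reals all_analysis.
From mathcomp Require Import measurable_realfun ring lra.

(** Let [P] be the orthogonal projection onto the column span of [X], which has
    dimension [p], and let [e] be a standard Gaussian vector.  Every contrast
    [l] entering the PoSI statistic is a vector of norm at most one in that
    span, and there are at most [p * 2 ^ p] of them.  A plain union bound over
    the [l] would only give the constant [sqrt (2 * ln 2)]; the sharper
    [sqrt 3 / 2] comes from using that [|Pe|^2] concentrates around [p], so
    that [|l.e|] can exceed [K] either because [|Pe|^2] is atypically large or
    because [Pe] has an atypical direction.

    Both events are handled by exponential moments.  With [t] slightly above
    [p], the indicator of [K < max_stat] is at most
      [exp (th * (|Pe|^2 - t))
        + sum over l of exp (3/2 * (t - |Pe|^2) + (2 - s) * ((l.e)^2 - K^2))].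
    The expectation of each summand is the integral of the exponential of a
    quadratic form ([gaussian_spiked_integral]); the exponent [3/2] makes the
    factor [E exp (- 3/2 * |Pe|^2)], namely [4 ^ (- p / 2) = 2 ^ (- p)],
    cancel the number [2 ^ p] of submodels.  What remains in the exponent is
    [3/2 * t - (2 - s) * K^2], negative of order [p] as soon as [K^2] is a bit
    larger than [3/4 * p]: this is where [sqrt 3 / 2] comes from.

    The Gaussian law enters through the identity
    [E exp ((|e|^2 - e S e^T) / 2) = (det S)^(-1/2)] for positive definite [S]
    ([gaussian_quadratic_integral]), proved coordinate by coordinate:
    completing the square in the first coordinate replaces [S] by its Schur
    complement, and the determinant factors accordingly.  For the forms above
    the determinant is then computed with Sylvester's identity
    ([det_spiked]). *)

Import Order.TTheory GRing.Theory Num.Theory.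
Import numFieldNormedType.Exports.
Local Open Scope classical_set_scope.
Local Open Scope ring_scope.

(** * Gaussian integrals in one variable *)

(** The Radon-Nikodym derivative of [normal_prob] is characterised up to null
    sets by its integrals, hence it may be taken to be [normal_pdf]. *)
Lemma ge0_integral_normal_prob {R : realType} (m s : R) (f : R -> \bar R) :
  measurable_fun setT f -> (forall x, 0 <= f x)%E ->
  (\int[normal_prob m s]_x f x =
   \int[lebesgue_measure]_x (f x * (normal_pdf m s x)%:E))%E.
Proof.
move=> mf f0; have dom := normal_prob_dominates m s.
rewrite -(Radon_Nikodym_SigmaFinite.change_of_variables dom)//.
have RNint := Radon_Nikodym_SigmaFinite.f_integrable dom.
have mpdf : measurable_fun setT (fun x => (normal_pdf m s x)%:E).
  by apply/measurable_EFinP; exact: measurable_normal_pdf.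
apply: ae_eq_integral => //.
- by apply: emeasurable_funM => //; exact: (measurable_int _ RNint).
- exact: emeasurable_funM.
- apply: ae_eqe_mul2l; apply: integral_ae_eq => //.
  by move=> E _ mE; rewrite -Radon_Nikodym_SigmaFinite.f_integral.
Qed.

Lemma measurable_expR_quadratic {R : realType} (s t : R) :
  measurable_fun setT
    (fun x : R => (expR ((x ^+ 2 - s * x ^+ 2 - x * t *+ 2) / 2))%:E).
Proof.
apply/measurable_EFinP; apply: measurableT_comp => //.
apply: measurable_funM => //; apply: measurable_funB; last first.
  by under eq_fun do rewrite -mulrnAr; apply: measurable_funM.
by apply: measurable_funB; [exact: measurable_funX|
  apply: measurable_funM => //; exact: measurable_funX].
Qed.

Lemma integral_normal_expR_quadratic {R : realType} (s t : R) : 0 < s ->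
  (\int[normal_prob 0 1]_x (expR ((x ^+ 2 - s * x ^+ 2 - x * t *+ 2) / 2))%:E =
   ((Num.sqrt s)^-1 * expR (t ^+ 2 / s / 2))%:E)%E.
Proof.
move=> s0; rewrite ge0_integral_normal_prob//; last exact: measurable_expR_quadratic.
(* Completing the square: up to a factor, the integrand is the density of
   the normal law of mean [- t / s] and variance [1 / s]. *)
set m := - (t / s); set sg := (Num.sqrt s)^-1.
have sq0 : 0 < Num.sqrt s by rewrite sqrtr_gt0.
have sg0 : sg != 0 by rewrite invr_neq0// gt_eqF.
have sg2 : sg ^+ 2 = s^-1 by rewrite exprVn sqr_sqrtr// ltW.
have peak : normal_peak 1 = sg * normal_peak sg :> R.
  rewrite /normal_peak sg2 expr1n mul1r -mulrnAr [in RHS]sqrtrM ?invr_ge0 1?ltW//.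
  by rewrite sqrtrV 1?ltW// invfM invrK mulrA mulVf ?mul1r// gt_eqF.
under eq_integral => x _.
  have -> : ((expR ((x ^+ 2 - s * x ^+ 2 - x * t *+ 2) / 2))%:E *
     (normal_pdf 0 1 x)%:E =
     (sg * expR (t ^+ 2 / s / 2))%:E * (normal_pdf m sg x)%:E)%E.
    rewrite -!EFinM; congr EFin.
    rewrite !normal_pdfE ?oner_neq0// peak /normal_fun sg2.
    rewrite [LHS]mulrCA [RHS]mulrACA; congr (_ * _).
    rewrite -!expRD; congr expR.
    by rewrite /m; field; rewrite gt_eqF.
  over.
rewrite ge0_integralZl//.
- by rewrite integral_normal_pdf mule1.
- by apply/measurable_EFinP; exact: measurable_normal_pdf.
- by move=> x _; rewrite lee_fin normal_pdf_ge0.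
- by rewrite lee_fin mulr_ge0 ?expR_ge0 ?invr_ge0 ?sqrtr_ge0.
Qed.

(** * Gaussian integrals of quadratic forms *)

Section QuadraticForms.
Context {R : realType}.

Definition qform {n} (S : 'M[R]_n) (x : 'rV[R]_n) : R := (x *m S *m x^T) 0 0.

Definition posdef {n} (S : 'M[R]_n) : Prop :=
  S^T = S /\ forall x : 'rV[R]_n, x != 0 -> 0 < qform S x.

Lemma qform_block {n} (s : R) (q : 'rV[R]_n) (S : 'M[R]_n) (a : R) (y : 'rV[R]_n) :
  qform (block_mx s%:M q q^T S : 'M[R]_(1 + n)) (row_mx a%:M y) =
  s * a ^+ 2 + a * (y *m q^T) 0 0 *+ 2 + qform S y.
Proof.
have addE (A B : 'M[R]_1) : (A + B) 0 0 = A 0 0 + B 0 0 by rewrite mxE.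
have scalE (c : R) (A : 'M[R]_1) : (A *m c%:M) 0 0 = c * A 0 0.
  by rewrite mul_mx_scalar mxE.
rewrite /qform mul_row_block tr_row_mx mul_row_col !mulmxDl !addE.
rewrite tr_scalar_mx !scalE !mul_scalar_mx -scalemxAl.
have -> : (a *: (q *m y^T)) 0 0 = a * (y *m q^T) 0 0.
  by rewrite mxE -[q *m _]trmxK trmx_mul trmxK [X in _ * X]mxE.
by rewrite !mxE !eqxx !mulr1n; ring.
Qed.

(** One step of block Gaussian elimination. *)
Lemma det_block_schur {n} (s : R) (q : 'rV[R]_n) (S : 'M[R]_n) : s != 0 ->
  \det (block_mx s%:M q q^T S : 'M[R]_(1 + n)) = s * \det (S - s^-1 *: (q^T *m q)).
Proof.
move=> s0.
have -> : (block_mx s%:M q q^T S : 'M[R]_(1 + n)) =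
    block_mx 1%:M 0 (s^-1 *: q^T) 1%:M *m
    block_mx s%:M q 0 (S - s^-1 *: (q^T *m q)).
  rewrite mulmx_block !mul1mx !mul0mx ?mulmx0 !addr0 mul_mx_scalar scalerA.
  by rewrite divff// scale1r -scalemxAl addrC subrK.
by rewrite det_mulmx det_lblock det_ublock !det1 !mul1r det_scalar1.
Qed.

Lemma qform_schur {n} (s : R) (q : 'rV[R]_n) (S : 'M[R]_n) (y : 'rV[R]_n) :
  qform (S - s^-1 *: (q^T *m q)) y = qform S y - (y *m q^T) 0 0 ^+ 2 / s.
Proof.
have subE (A B : 'M[R]_1) : (A - B) 0 0 = A 0 0 - B 0 0 by rewrite !mxE.
have scalE (c : R) (A : 'M[R]_1) : (c *: A) 0 0 = c * A 0 0 by rewrite mxE.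
rewrite /qform mulmxBr mulmxBl subE -scalemxAr -scalemxAl scalE !mulmxA.
have -> : (y *m q^T *m q *m y^T) = (y *m q^T) *m (y *m q^T)^T.
  by rewrite trmx_mul trmxK !mulmxA.
set t := y *m q^T; rewrite [in LHS](mx11_scalar t) tr_scalar_mx -scalar_mxM.
by rewrite [fun_of_matrix (_ * _)%:M 0 0]mxE eqxx mulr1n; ring.
Qed.

(** The Schur complement at [y] is the minimum of the full form over the
    first coordinate, attained at [- (y q^T) / s]. *)
Lemma posdef_schur {n} (s : R) (q : 'rV[R]_n) (S : 'M[R]_n) :
  posdef (block_mx s%:M q q^T S : 'M[R]_(1 + n)) ->
  0 < s /\ posdef (S - s^-1 *: (q^T *m q)).
Proof.
move=> [sym pos].
have s0 : 0 < s.
  have := pos (row_mx 1%:M 0); rewrite qform_block /qform !mul0mx !mxE.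
  rewrite mulr0 mul0rn expr1n mulr1 !addr0; apply.
  apply/eqP => /rowP/(_ 0); rewrite mxE; case: splitP => // j j0.
  by rewrite !mxE (ord1 j)/= => /eqP; rewrite oner_eq0.
split=> //; split.
  move: sym; rewrite tr_block_mx => /eq_block_mx[_ _ _ St].
  by rewrite linearB linearZ /= St trmx_mul trmxK.
move=> y y0; have := pos (row_mx (- ((y *m q^T) 0 0 / s))%:M y).
rewrite qform_block qform_schur.
set t := (y *m q^T) 0 0.
have -> : s * (- (t / s)) ^+ 2 + - (t / s) * t *+ 2 + qform S y
  = qform S y - t ^+ 2 / s by field; rewrite gt_eqF.
by apply; apply: contra_neq y0; rewrite -row_mx0 => /eq_row_mx[].
Qed.

Definition rv_of {n} (e : n.-tuple (measurableTypeR R)) : 'rV[R]_n :=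
  \row_i tnth e i.

Lemma measurable_qform {n} (S : 'M[R]_n) :
  measurable_fun setT (fun e : n.-tuple (measurableTypeR R) => qform S (rv_of e)).
Proof.
rewrite /qform; under eq_fun do rewrite mxE.
apply: measurable_sum => i.
under eq_fun do rewrite !mxE.
apply: measurable_funM; last exact: measurable_tnth.
apply: measurable_sum => j; under eq_fun do rewrite mxE.
by apply: measurable_funM => //; exact: measurable_tnth.
Qed.

Lemma measurable_expR_qformB {n} (S T : 'M[R]_n) :
  measurable_fun setT (fun e : n.-tuple (measurableTypeR R) =>
    (expR ((qform S (rv_of e) - qform T (rv_of e)) / 2))%:E).
Proof.
apply/measurable_EFinP; apply: measurableT_comp => //.
by apply: measurable_funM => //; apply: measurable_funB; exact: measurable_qform.
Qed.

Lemma rv_of_cons {n} (a : R) (e : n.-tuple (measurableTypeR R)) :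
  rv_of (tcons (a, e)) = row_mx a%:M (rv_of e) :> 'rV[R]_(1 + n).
Proof.
apply/rowP => i; rewrite !mxE; case: splitP => j ij.
  by rewrite !mxE (ord1 j) eqxx mulr1n (tnth_nth 0)/= ij (ord1 j).
by rewrite mxE !(tnth_nth 0)/= ij.
Qed.

(** Tonelli's theorem, with the first coordinate in the inner integral: there
    it will be integrated with the others held fixed. *)
Lemma std_gaussian_integral_cons {n} (f : n.+1.-tuple (measurableTypeR R) -> \bar R) :
  measurable_fun setT f -> (forall e, 0 <= f e)%E ->
  (\int[std_gaussian R n.+1]_e f e =
   \int[std_gaussian R n]_e \int[normal_prob 0 1]_a f (tcons (a, e)))%E.
Proof.
move=> mf f0; rewrite /= ge0_integral_distribution//.
have mft : measurable_fun setT (f \o @tcons R n).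
  by apply: measurableT_comp => //; exact: measurable_tcons.
have ft0 x : (0 <= (f \o @tcons R n) x)%E by exact: f0.
rewrite fubini_tonelli1//.
exact: (@fubini_tonelli _ _ _ _ _ (normal_prob 0 1) (std_gaussian R n) _ mft).
Qed.

(** Induction on the dimension: by [integral_normal_expR_quadratic], integrating
    the first coordinate yields the factor [1 / sqrt s] and changes the form on
    the others into the Schur complement, whose determinant is [\det S / s]
    by [det_block_schur]. *)
Lemma gaussian_quadratic_integral {n} (S : 'M[R]_n) : posdef S ->
  0 < \det S /\
  (\int[std_gaussian R n]_e
     (expR ((qform 1%:M (rv_of e) - qform S (rv_of e)) / 2))%:E =
   ((Num.sqrt (\det S))^-1)%:E)%E.
Proof.
elim: n S => [|n IHn] S Spos.
  rewrite det_mx00 ltr01; split=> //.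
  rewrite /= integral_dirac//=; last exact: measurable_expR_qformB.
  rewrite diracT mul1e /qform !mxE !big_ord0 subrr mul0r expR0.
  by rewrite sqrtr1 invr1.
pose s : R := S 0 0; pose q : 'rV[R]_n := @ursubmx R 1 n 1 n S.
pose S' : 'M[R]_n := @drsubmx R 1 n 1 n S.
have SE : S = (block_mx s%:M q q^T S' : 'M[R]_(1 + n)).
  have ulE : @ulsubmx R 1 n 1 n S = s%:M.
    by rewrite [LHS]mx11_scalar !mxE; congr (S _ _)%:M; apply/val_inj.
  have dlE : @dlsubmx R 1 n 1 n S = q^T by rewrite trmx_ursub (proj1 Spos).
  by rewrite -ulE -dlE; exact: esym (@submxK R 1 n 1 n S).
have [s0 Tpos] : 0 < s /\ posdef (S' - s^-1 *: (q^T *m q)).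
  by apply: posdef_schur; rewrite -SE.
have [T0 IT] := IHn _ Tpos.
have detE : \det S = s * \det (S' - s^-1 *: (q^T *m q)).
  by rewrite {1}SE det_block_schur// gt_eqF.
split; first by rewrite detE mulr_gt0.
rewrite std_gaussian_integral_cons; first last.
- by move=> e; rewrite lee_fin expR_ge0.
- exact: measurable_expR_qformB.
(* Integrating out the first coordinate [a] turns [S] into [S' - q^T q / s]. *)
under eq_integral => e _.
  under eq_integral => a _.
    have -> : (expR ((qform 1%:M (rv_of (tcons (a, e))) -
                      qform S (rv_of (tcons (a, e)))) / 2))%:E =
      ((expR ((qform 1%:M (rv_of e) - qform S' (rv_of e)) / 2))%:E *
       (expR ((a ^+ 2 - s * a ^+ 2 - a * (rv_of e *m q^T) 0 0 *+ 2) / 2))%:E)%E.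
      rewrite -EFinM -expRD rv_of_cons {1}SE qform_block.
      rewrite (_ : 1%:M = block_mx 1%:M 0 0^T 1%:M :> 'M[R]_(1 + n)); last first.
        by rewrite trmx0 -scalar_mx_block.
      rewrite qform_block trmx0 mulmx0 mxE; congr (expR _)%:E.
      by field.
    over.
  rewrite ge0_integralZl//; last exact: measurable_expR_quadratic.
  rewrite integral_normal_expR_quadratic//.
  have -> : ((expR ((qform 1%:M (rv_of e) - qform S' (rv_of e)) / 2))%:E *
     ((Num.sqrt s)^-1 * expR ((rv_of e *m q^T) 0 0 ^+ 2 / s / 2))%:E =
     (Num.sqrt s)^-1%:E * (expR ((qform 1%:M (rv_of e) -
        qform (S' - s^-1 *: (q^T *m q)) (rv_of e)) / 2))%:E)%E.
    rewrite -!EFinM mulrCA -expRD qform_schur; congr (_ * expR _)%:E.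
    by field; rewrite gt_eqF.
  over.
rewrite ge0_integralZl//; last exact: measurable_expR_qformB.
by rewrite IT -EFinM detE sqrtrM ?(ltW s0)// invfM.
Qed.

End QuadraticForms.

(** * Projections and rank-one perturbations *)

Section Projections.
Context {R : realType}.

Definition dot {n} (x y : 'rV[R]_n) : R := (x *m y^T) 0 0.

Lemma dotC {n} (x y : 'rV[R]_n) : dot x y = dot y x.
Proof. by rewrite /dot -[x *m _]trmxK trmx_mul trmxK mxE. Qed.

Lemma dotBl {n} (x y z : 'rV[R]_n) : dot (x - y) z = dot x z - dot y z.
Proof. by rewrite /dot mulmxBl !mxE. Qed.

Lemma dotZl {n} a (x z : 'rV[R]_n) : dot (a *: x) z = a * dot x z.
Proof. by rewrite /dot -scalemxAl !mxE. Qed.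

Lemma dotE {n} (x y : 'rV[R]_n) : dot x y = \sum_i x 0 i * y 0 i.
Proof. by rewrite /dot mxE; apply: eq_bigr => i _; rewrite mxE. Qed.

Lemma dot_ge0 {n} (x : 'rV[R]_n) : 0 <= dot x x.
Proof. by rewrite dotE; apply: sumr_ge0 => i _; rewrite -expr2 sqr_ge0. Qed.

Lemma dot_eq0 {n} (x : 'rV[R]_n) : (dot x x == 0) = (x == 0).
Proof.
apply/eqP/eqP => [|->]; last by rewrite /dot mul0mx mxE.
rewrite dotE => /eqP; rewrite psumr_eq0 => [/allP x0|i _]; last first.
  by rewrite -expr2 sqr_ge0.
apply/rowP => i; rewrite [RHS]mxE; apply/eqP.
by have := x0 i (mem_index_enum _); rewrite mulf_eq0 orbb.
Qed.

Lemma qform1 {n} (x : 'rV[R]_n) : qform 1%:M x = dot x x.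
Proof. by rewrite /qform mulmx1. Qed.

Lemma qform_dot {n} (S : 'M[R]_n) (x : 'rV[R]_n) : qform S x = dot (x *m S) x.
Proof. by []. Qed.

(** Sylvester's identity: the two sides are the two Schur complements of the
    block matrix with diagonal blocks [1] and off-diagonal blocks [V], [U]. *)
Lemma det_sylvester {m n} (U : 'M[R]_(n, m)) (V : 'M[R]_(m, n)) :
  \det (1%:M - U *m V) = \det (1%:M - V *m U).
Proof.
have E1 : block_mx 1%:M V U 1%:M =
    block_mx 1%:M 0 U 1%:M *m block_mx 1%:M V 0 (1%:M - U *m V).
  by rewrite mulmx_block !mul1mx !mul0mx !mulmx1 !addr0 subrKC.
have E2 : block_mx 1%:M V U 1%:M =
    block_mx (1%:M - V *m U) V 0 1%:M *m block_mx 1%:M 0 U 1%:M.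
  by rewrite mulmx_block !mul1mx !mul0mx !mulmx1 mulmx0 !add0r subrK.
have := congr1 (fun M => \det M) (etrans (esym E1) E2).
by rewrite !det_mulmx !det_lblock !det_ublock !det1 !mul1r !mulr1.
Qed.

(** The orthogonal projection onto the row space of [A], in closed form so that
    its determinants reduce to [p * p] ones; meaningful when the rows of [A]
    are independent. *)
Definition rowproj {p n} (A : 'M[R]_(p, n)) : 'M[R]_n :=
  A^T *m invmx (A *m A^T) *m A.

Section RowProj.
Context {p n : nat}.
Variables (A : 'M[R]_(p, n)) (Afree : row_free A).

(** If [v A A^T = 0] then [v A] has norm zero. *)
Lemma gram_unit : A *m A^T \in unitmx.
Proof.
rewrite -row_free_unit -kermx_eq0; apply/rowV0P => v /sub_kermxP vAA.
have : v *m A = 0.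
  by apply/eqP; rewrite -dot_eq0 /dot trmx_mul -mulmxA (mulmxA A) mulmxA vAA
    mul0mx mxE.
by rewrite -(mul0mx _ A) => /(row_free_inj Afree).
Qed.

Lemma rowproj_tr : (rowproj A)^T = rowproj A.
Proof. by rewrite /rowproj !trmx_mul trmxK trmx_inv trmx_mul trmxK mulmxA. Qed.

Lemma rowproj_id {m} (x : 'M[R]_(m, n)) : (x <= A)%MS -> x *m rowproj A = x.
Proof.
move=> /submxP[w ->]; rewrite /rowproj !mulmxA -(mulmxA w) mulmxK//.
exact: gram_unit.
Qed.

Lemma rowproj_idem : rowproj A *m rowproj A = rowproj A.
Proof. by rewrite rowproj_id// submxMl. Qed.

Lemma det_rowproj t : \det (1%:M - t *: rowproj A) = (1 - t) ^+ p.
Proof.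
rewrite /rowproj -mulmxA scalemxAr det_sylvester -scalemxAl -mulmxA mulVmx ?gram_unit//.
by rewrite -det_scalar scale_scalar_mx mulr1 raddfB.
Qed.

Variables (l : 'rV[R]_n) (lA : (l <= A)%MS) (l1 : dot l l <= 1).

Lemma dot_rowproj (x : 'rV[R]_n) : dot (x *m rowproj A) l = dot x l.
Proof. by rewrite /dot -mulmxA -{1}rowproj_tr -trmx_mul rowproj_id. Qed.

Lemma qform_rowproj (x : 'rV[R]_n) :
  qform (rowproj A) x = dot (x *m rowproj A) (x *m rowproj A).
Proof.
rewrite /qform /dot trmx_mul rowproj_tr (mulmxA _ (rowproj A)).
by rewrite -(mulmxA x (rowproj A) (rowproj A)) rowproj_idem.
Qed.

(** The difference is the squared norm of [x - xP]. *)
Lemma qform_rowproj_le (x : 'rV[R]_n) : qform (rowproj A) x <= dot x x.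
Proof.
have := dot_ge0 (x - x *m rowproj A).
rewrite dotBl !(dotC _ (x - _)) !dotBl (dotC x) -qform_rowproj -qform_dot.
by rewrite subrr subr0 subr_ge0.
Qed.

(** Bessel's inequality for the direction [l], from the squared norm of
    [xP - (x.l) l]. *)
Lemma sqr_dot_le (x : 'rV[R]_n) : dot x l ^+ 2 <= qform (rowproj A) x.
Proof.
have := dot_ge0 (x *m rowproj A - dot x l *: l).
have -> (y : 'rV[R]_n) d : dot (y - d *: l) (y - d *: l) =
    dot y y - 2 * d * dot y l + d ^+ 2 * dot l l.
  rewrite dotBl dotZl (dotC y) (dotC l) !dotBl !dotZl (dotC l y).
  by ring.
rewrite -qform_rowproj dot_rowproj => h.
have : dot x l ^+ 2 * dot l l <= dot x l ^+ 2 by rewrite ler_piMr ?sqr_ge0.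
by lra.
Qed.

(** The matrix whose Gaussian integral is [E exp (b |eP|^2 + c (e.l)^2)]. *)
Definition spiked (b c : R) : 'M[R]_n :=
  1%:M - (2 * b) *: rowproj A - (2 * c) *: (l^T *m l).

Lemma qform_spiked b c (x : 'rV[R]_n) :
  qform (spiked b c) x = dot x x - 2 * b * qform (rowproj A) x - 2 * c * dot x l ^+ 2.
Proof.
rewrite qform_dot /spiked !mulmxBr mulmx1 !dotBl -!scalemxAr !dotZl.
congr (_ - _ * _); rewrite mulmxA [x *m l^T]mx11_scalar mul_scalar_mx dotZl.
by rewrite (dotC l) expr2.
Qed.

(** Since [(x.l)^2 <= |xP|^2 <= |x|^2], the form is bounded below by
    [(|x|^2 - |xP|^2) + (1 - 2b - 2c) |xP|^2]; the case [xP = 0] is separate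
    because the second term then vanishes. *)
Lemma posdef_spiked b c : 0 <= c -> 2 * b + 2 * c < 1 -> posdef (spiked b c).
Proof.
move=> c0 bc; split.
  rewrite /spiked !linearB !linearZ/= tr_scalar_mx rowproj_tr.
  by rewrite trmx_mul trmxK.
move=> x x0; rewrite qform_spiked.
have xx0 : 0 < dot x x by rewrite lt_def dot_eq0 x0 dot_ge0.
have := qform_rowproj_le x; have := sqr_dot_le x.
have := sqr_ge0 (dot x l).
move: (qform _ x) (dot x l ^+ 2) => B D D0 DB BX.
have [B0|B0] := leP B 0.
  have B00 : B = 0 by apply/eqP; rewrite eq_le B0 (le_trans D0).
  have D00 : D = 0 by apply/eqP; rewrite eq_le D0 -B00 DB.
  by rewrite B00 D00 !mulr0 !subr0.
have : 0 < (1 - 2 * b - 2 * c) * B by rewrite mulr_gt0//; lra.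
have : 0 <= c * (B - D) by rewrite mulr_ge0//; lra.
by lra.
Qed.

(** As [l] is an eigenvector of [1 - 2b P] for [1 - 2b], the rank-one term can be
    factored out. *)
Lemma det_spiked b c : 2 * b < 1 ->
  \det (spiked b c) = (1 - 2 * b) ^+ p * (1 - 2 * c / (1 - 2 * b) * dot l l).
Proof.
move=> b1; have b0 : 1 - 2 * b != 0 by rewrite gt_eqF// subr_gt0.
have -> : spiked b c = (1%:M - (2 * b) *: rowproj A) *m
   (1%:M - (2 * c / (1 - 2 * b)) *: l^T *m l).
  rewrite mulmxBr mulmx1 /spiked; congr (_ - _).
  rewrite -!scalemxAl -scalemxAr !mulmxBl mul1mx -scalemxAl mulmxA.
  rewrite -[rowproj A *m l^T]trmxK trmx_mul trmxK rowproj_tr rowproj_id//.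
  have subZ (M : 'M[R]_n) k : M - k *: M = (1 - k) *: M.
    by rewrite scalerBl scale1r.
  rewrite subZ scalerA; congr (_ *: _).
  by rewrite divfK.
rewrite det_mulmx det_rowproj det_sylvester -scalemxAr; congr (_ * _).
by rewrite [X in _ *: X]mx11_scalar scale_scalar_mx -raddfB det_scalar1.
Qed.

(** Allowing [dot l l < 1] covers [l = 0], which is what [unit_adjusted] returns
    on a vanishing residual, and lets the term without [l] be an instance. *)
Lemma gaussian_spiked_integral b c : 0 <= c -> 2 * b + 2 * c < 1 ->
  (\int[std_gaussian R n]_e
     (expR (b * qform (rowproj A) (rv_of e) + c * dot (rv_of e) l ^+ 2))%:E =
   ((Num.sqrt ((1 - 2 * b) ^+ p * (1 - 2 * c / (1 - 2 * b) * dot l l)))^-1)%:E)%E.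
Proof.
move=> c0 bc; rewrite -det_spiked; last by lra.
rewrite -(proj2 (gaussian_quadratic_integral _ (posdef_spiked _ _ c0 bc))).
apply: eq_integral => e _; rewrite qform1 qform_spiked; congr (expR _)%:E.
by field.
Qed.

End RowProj.

End Projections.

(** * The tail of the PoSI statistic *)

Lemma probability_le_integral {d} {T : measurableType d} {R : realType}
    (P : probability T R) (A : set T) (f : T -> R) :
  measurable A -> measurable_fun setT f -> (forall x, 0 <= f x) ->
  (forall x, A x -> 1 <= f x) -> (P A <= \int[P]_x (f x)%:E)%E.
Proof.
move=> mA mf f0 f1; rewrite -[P A]mul1e -integral_cst//.
apply: (@le_trans _ _ (\int[P]_(x in A) (f x)%:E)%E).
  apply: ge0_le_integral => //=.
  by apply/measurable_EFinP; exact: measurable_funTS.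
apply: ge0_subset_integral => //; first exact/measurable_EFinP.
by move=> x _; rewrite lee_fin.
Qed.

Section Design.
Context {R : realType} {n p : nat}.
Variable X : 'M[R]_(n, p).

Lemma regressor_sub j : (regressor X j <= X^T)%MS.
Proof. by rewrite /regressor tr_col row_sub. Qed.

Lemma unit_adjusted_sub M j : (unit_adjusted X M j <= X^T)%MS.
Proof.
apply: scalemx_sub; have [h _] := adjustedP X M j.
rewrite -(subKr (regressor X j) (adjusted X M j)) addmx_sub ?regressor_sub//.
rewrite -scaleN1r scalemx_sub// (submx_trans h)//.
by apply/sumsmx_subP => k _; rewrite genmxE regressor_sub.
Qed.

Lemma dot_unit_adjusted M j : dot (unit_adjusted X M j) (unit_adjusted X M j) <= 1.
Proof.
rewrite /unit_adjusted; set a := adjusted X M j.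
have aE : l2norm a = Num.sqrt (dot a a).
  by rewrite /l2norm dotE; congr Num.sqrt; apply: eq_bigr => i _; rewrite expr2.
rewrite dotZl dotC dotZl mulrA -expr2 exprVn aE sqr_sqrtr ?dot_ge0//.
by have [->|a0] := eqVneq (dot a a) 0; rewrite ?mulr0// mulVf.
Qed.

Lemma measurable_max_stat_gt (MM : {set {set 'I_p}}) K :
  measurable [set e | K < max_stat X MM e].
Proof.
rewrite (_ : [set e | _] = setT `&` max_stat X MM @^-1` `]K, +oo[%classic).
  by apply: measurable_max_stat => //; exact: measurable_itv.
by rewrite setTI; apply/seteqP; split=> e; rewrite /= in_itv/= andbT.
Qed.

Lemma max_stat_gt (MM : {set {set 'I_p}}) e K : 0 <= K -> K < max_stat X MM e ->
  exists M j, K < `|dot (rv_of e) (unit_adjusted X M j)|.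
Proof.
move=> K0; rewrite ltNge => /negP Kmax; apply: contrapT => noM; apply: Kmax.
rewrite /max_stat; elim/big_ind: _ => // [x y xK yK|M _]; first by rewrite ge_max xK.
elim/big_ind: _ => // [x y xK yK|j _]; first by rewrite ge_max xK.
rewrite leNgt; apply/negP => h; apply: noM; exists M, j.
suff -> : dot (rv_of e) (unit_adjusted X M j) =
  \sum_(i < n) unit_adjusted X M j 0 i * tnth e i by [].
by rewrite dotC dotE; apply: eq_bigr => i _; rewrite [X in _ * X]mxE.
Qed.

Lemma measurable_dot (l : 'rV[R]_n) :
  measurable_fun setT (fun e : n.-tuple (measurableTypeR R) => dot (rv_of e) l).
Proof.
under eq_fun do rewrite dotE; apply: measurable_sum => i.
under eq_fun do rewrite [X in X * _]mxE.
by apply: measurable_funM => //; exact: measurable_tnth.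
Qed.

Hypothesis rX : \rank X = p.

(** Union bound in exponential form.  The sum of the moments runs over all pairs [(M, j)], even with [j] outside [M]: the vector [unit_adjusted M j]
    still lies in the span and has norm at most one. *)
Lemma max_stat_tail (MM : {set {set 'I_p}}) (K t th s : R) :
  0 <= K -> 0 <= th -> 2 * th < 1 -> 0 < s <= 2 ->
  (std_gaussian R n [set e | (K < max_stat X MM e)%R] <=
   (expR (- (th * t)) / Num.sqrt ((1 - 2 * th) ^+ p) +
    (expR (3 / 2 * t - (2 - s) * K ^+ 2) / Num.sqrt (4 ^+ p * (s / 2)))
      *+ (2 ^ p * p))%:E)%E.
Proof.
move=> K0 th0 th1 /andP[s0 s2].
have Xfree : row_free X^T by rewrite /row_free mxrank_tr rX.
pose Q e := qform (rowproj X^T) (rv_of e).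
(* [f0] dominates the event [t <= Q e], where [Q e = |Pe|^2], and the sum of
   the [f Mj] its complement within [K < max_stat]. *)
pose f0 e := expR (- (th * t)) * expR (th * Q e).
pose f (Mj : {set 'I_p} * 'I_p) e := expR (3 / 2 * t - (2 - s) * K ^+ 2) *
  expR (- (3 / 2) * Q e + (2 - s) * dot (rv_of e) (unit_adjusted X Mj.1 Mj.2) ^+ 2).
have mf0 : measurable_fun setT f0.
  apply: measurable_funM => //; apply: measurableT_comp => //.
  by apply: measurable_funM => //; exact: measurable_qform.
have mf Mj : measurable_fun setT (f Mj).
  apply: measurable_funM => //; apply: measurableT_comp => //.
  apply: measurable_funD; first by apply: measurable_funM => //; exact: measurable_qform.
  by apply: measurable_funM => //; apply: measurable_funX; exact: measurable_dot.
have f0_ge0 e : 0 <= f0 e by rewrite mulr_ge0 ?expR_ge0.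
have f_ge0 Mj e : 0 <= f Mj e by rewrite mulr_ge0 ?expR_ge0.
apply: (@le_trans _ _ (\int[std_gaussian R n]_e (f0 e + \sum_Mj f Mj e)%:E)%E).
  apply: probability_le_integral.
  - exact: measurable_max_stat_gt.
  - by apply: measurable_funD => //; exact: measurable_sum.
  - by move=> e; rewrite addr_ge0// sumr_ge0.
  - move=> e /= /(max_stat_gt _ _ _ K0)[M [j KMj]].
    have [Qt|Qt] := leP t (Q e).
      apply: (@le_trans _ _ (f0 e)); last by rewrite lerDl sumr_ge0.
      by rewrite /f0 -expRD -[leLHS]expR0 ler_expR addrC subr_ge0 ler_wpM2l.
    apply: (@le_trans _ _ (f (M, j) e)).
      rewrite /f -expRD -[leLHS]expR0 ler_expR /=.
      have : K ^+ 2 <= dot (rv_of e) (unit_adjusted X M j) ^+ 2.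
        by rewrite -[leRHS]real_normK ?num_real// lerXn2r ?nnegrE// ltW.
      move: (dot _ _ ^+ 2) (K ^+ 2) (Q e) Qt => D k q qt kD.
      have : 0 <= (2 - s) * (D - k) by rewrite mulr_ge0// subr_ge0.
      by lra.
    by rewrite (bigD1 (M, j))//= addrCA lerDl addr_ge0// sumr_ge0.
under eq_integral do rewrite EFinD -sumEFin.
rewrite ge0_integralD//; last 4 first.
- by move=> e _; rewrite lee_fin.
- exact/measurable_EFinP.
- by move=> e _; rewrite sumEFin lee_fin sumr_ge0.
- under eq_fun do rewrite sumEFin; apply/measurable_EFinP; exact: measurable_sum.
rewrite EFinD leeD//.
  under eq_integral do rewrite /f0 EFinM.
  rewrite ge0_integralZl//; last first.
    apply/measurable_EFinP; apply: measurableT_comp => //.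
    by apply: measurable_funM => //; exact: measurable_qform.
  have dot00 : dot (0 : 'rV[R]_n) 0 <= 1 by rewrite /dot mul0mx mxE ler01.
  have th1' : 2 * th + 2 * 0 < 1 by rewrite mulr0 addr0.
  have := gaussian_spiked_integral _ Xfree _ (sub0mx _ _) dot00 _ _ (lexx 0) th1'.
  rewrite mulr0 !mul0r subr0 mulr1 EFinM => <-.
  by under [in leRHS]eq_integral do rewrite mul0r addr0.
rewrite ge0_integral_sum//; last 2 first.
- by move=> Mj; exact/measurable_EFinP.
- by move=> Mj e _; rewrite lee_fin.
have -> : (2 ^ p * p)%N = #|{: {set 'I_p} * 'I_p}|.
  by rewrite card_prod card_ord -cardsT -powersetT card_powerset cardsT card_ord.
rewrite -sumr_const -sumEFin; apply: lee_sum => Mj _.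
under eq_integral do rewrite /f EFinM.
rewrite ge0_integralZl//; last first.
  apply/measurable_EFinP; apply: measurableT_comp => //.
  apply: measurable_funD; first by apply: measurable_funM => //; exact: measurable_qform.
  by apply: measurable_funM => //; apply: measurable_funX; exact: measurable_dot.
set l := unit_adjusted X Mj.1 Mj.2.
have l1 : dot l l <= 1 := dot_unit_adjusted _ _.
rewrite (gaussian_spiked_integral _ Xfree _ (unit_adjusted_sub _ _) l1); first last.
- by lra.
- by lra.
rewrite EFinM lee_wpmul2l// ?lee_fin ?expR_ge0//.
have -> : 1 - 2 * - (3 / 2) = 4 :> R by field.
have pos : 0 < 4 ^+ p * (s / 2) by rewrite mulr_gt0 ?exprn_gt0// divr_gt0.
rewrite lef_pV2 ?posrE ?sqrtr_gt0//; last first.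
  rewrite mulr_gt0 ?exprn_gt0//.
  have := dot_ge0 l; nra.
apply: ler_wsqrtr; rewrite ler_wpM2l ?exprn_ge0//.
have := dot_ge0 l; nra.
Qed.

End Design.

(** * Asymptotics in the number of regressors *)

Lemma sqrtr_expn {R : rcfType} (a : R) (n : nat) : 0 <= a ->
  Num.sqrt (a ^+ n) = Num.sqrt a ^+ n.
Proof.
move=> a0; elim: n => [|n IHn]; first by rewrite !expr0 sqrtr1.
by rewrite !exprS sqrtrM// IHn.
Qed.

Section Asymptotics.
Context {R : realType}.

(** The exponent optimising the Chernoff bound of [P (|Pe|^2 > (1 + d) p)] at
    [d = eta / 3], namely [d / (2 (1 + d))], for which
    [1 - 2 * norm_tilt = 1 / (1 + d)]. *)
Definition norm_tilt (eta : R) : R := eta / 3 / (1 + eta / 3) / 2.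

(** Chosen, together with [t = (1 + eta / 3) p], so that
    [3/2 * t - (2 - spike_slack) * (3/4 + eta) p = - eta p]: each of the two
    relaxations spends [eta / 2] out of the gain [2 eta]. *)
Definition spike_slack (eta : R) : R := eta / (2 * (3 / 4 + eta)).

(** The square root of [(1 + d) exp (- d)], for [d = eta / 3]. *)
Definition norm_rate (eta : R) : R :=
  expR (- (eta / 6)) * Num.sqrt (1 + eta / 3).

Lemma norm_rate_lt1 (eta : R) : 0 < eta -> `|norm_rate eta| < 1.
Proof.
move=> eta0; rewrite ger0_norm ?mulr_ge0 ?expR_ge0 ?sqrtr_ge0//.
rewrite /norm_rate expRN mulrC ltr_pdivrMr ?expR_gt0// mul1r.
rewrite -[ltRHS]ger0_norm ?expR_ge0// -sqrtr_sqr ltr_sqrt ?exprn_gt0 ?expR_gt0//.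
rewrite -expRM_natl (_ : 2%:R * (eta / 6) = eta / 3); last by field.
by rewrite expR_gt1Dx// gt_eqF// divr_gt0.
Qed.

Lemma norm_term (eta : R) (p : nat) : 0 < eta ->
  expR (- (norm_tilt eta * ((1 + eta / 3) * p%:R))) /
    Num.sqrt ((1 - 2 * norm_tilt eta) ^+ p) =
  norm_rate eta ^+ p.
Proof.
move=> eta0; have d0 : 0 < 1 + eta / 3 by rewrite addr_gt0// divr_gt0.
have -> : 1 - 2 * norm_tilt eta = (1 + eta / 3)^-1.
  by rewrite /norm_tilt; field; lra.
have -> : - (norm_tilt eta * ((1 + eta / 3) * p%:R)) = p%:R * - (eta / 6).
  by rewrite /norm_tilt; field; lra.
rewrite expRM_natl sqrtr_expn ?invr_ge0 1?ltW// sqrtrV 1?ltW//.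
by rewrite -exprVn invrK -exprMn.
Qed.

(** The number [2 ^ p] of submodels cancels against [sqrt (4 ^ p)], and half of
    [exp (- eta p)] absorbs the remaining factor [p]. *)
Lemma union_term_le (eta : R) (p : nat) : 0 < eta ->
  (expR (3 / 2 * ((1 + eta / 3) * p%:R) -
         (2 - spike_slack eta) * ((3 / 4 + eta) * p%:R)) /
    Num.sqrt (4 ^+ p * (spike_slack eta / 2))) *+ (2 ^ p * p) <=
  2 / eta / Num.sqrt (spike_slack eta / 2) * expR (- (eta / 2)) ^+ p.
Proof.
move=> eta0; have c0 : 0 < 3 / 4 + eta by lra.
set s := spike_slack eta; have s0 : 0 < s by rewrite divr_gt0// mulr_gt0.
have -> : 3 / 2 * ((1 + eta / 3) * p%:R) - (2 - s) * ((3 / 4 + eta) * p%:R) =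
    p%:R * - (eta / 2) + p%:R * - (eta / 2).
  by rewrite /s /spike_slack; field; lra.
have sq0 : 0 < Num.sqrt (s / 2) by rewrite sqrtr_gt0 divr_gt0.
have p2 : 0 < 2 ^+ p :> R by rewrite exprn_gt0.
rewrite sqrtrM ?exprn_ge0// sqrtr_expn//.
have -> : Num.sqrt 4 = 2 :> R.
  by rewrite (_ : 4 = 2 ^+ 2) ?sqrtr_sqr ?ger0_norm//; ring.
rewrite expRD -mulr_natr natrM natrX expRM_natl.
set q := expR (- (eta / 2)).
have -> : q ^+ p * q ^+ p / (2 ^+ p * Num.sqrt (s / 2)) * (2 ^+ p * p%:R) =
  (p%:R * q ^+ p) / Num.sqrt (s / 2) * q ^+ p.
  by field; rewrite !gt_eqF.
rewrite ler_wpM2r ?exprn_ge0 ?expR_ge0// ler_wpM2r ?invr_ge0 ?(ltW sq0)//.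
rewrite /q expRN exprVn -expRM_natl ler_pdivrMr ?expR_gt0//.
rewrite mulrAC ler_pdivlMr// -ler_pdivrMl//.
apply: le_trans (expR_ge1Dx _); lra.
Qed.

(** By minimality of the PoSI constant it suffices that the tail probability at
    the proposed value is at most [alpha]; the bound of [max_stat_tail] depends
    on [p] only and tends to zero geometrically, hence uniformly in [n]
    and [X]. *)
Lemma PoSI_const_eventually (alpha eta : R) : 0 < alpha < 1 -> 0 < eta ->
  \forall p \near \oo, forall n (X : 'M[R]_(n, p)), \rank X = p ->
    PoSI_const X (all_submodels p) alpha <= Num.sqrt (3 / 4 + eta) * Num.sqrt p%:R.
Proof.
move=> alpha01 eta0; have /andP[alpha0 _] := alpha01.
pose th := norm_tilt eta; pose s := spike_slack eta.
pose C := 2 / eta / Num.sqrt (s / 2).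
have c0 : 0 < 3 / 4 + eta by lra.
have d0 : 0 < 1 + eta / 3 by lra.
have q1 : `|expR (- (eta / 2))| < 1.
  by rewrite ger0_norm ?expR_ge0// -[ltRHS]expR0 ltr_expR oppr_lt0 divr_gt0.
have : (fun p => geometric 1 (norm_rate eta) p + geometric C (expR (- (eta / 2))) p)
    @ \oo --> (0 + 0 : R).
  by apply: cvgD; apply: cvg_geometric => //; exact: norm_rate_lt1.
rewrite addr0 => /cvgr_lt/(_ _ alpha0).
apply: filterS => p bound n X rX.
have [_] := PoSI_constP X (all_submodels p) alpha01; apply.
set K := _ * _; have K0 : 0 <= K by rewrite mulr_ge0 ?sqrtr_ge0.
have -> : [set e | max_stat X (all_submodels p) e <= K] =
    ~` [set e | K < max_stat X (all_submodels p) e].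
  by apply/seteqP; split=> e /=; rewrite leNgt => /negP.
rewrite probability_setC; last exact: measurable_max_stat_gt.
rewrite EFinB leeB//.
have th0 : 0 <= th by rewrite !divr_ge0// ltW// divr_gt0.
have th1 : 2 * th < 1.
  by rewrite /th /norm_tilt mulrC divfK// ltr_pdivrMr// mul1r ltrDr.
have s02 : 0 < s <= 2.
  by rewrite divr_gt0 ?mulr_gt0//= ler_pdivrMr ?mulr_gt0//; lra.
have KE : K ^+ 2 = (3 / 4 + eta) * p%:R.
  by rewrite exprMn !sqr_sqrtr// ltW.
apply: (le_trans (max_stat_tail X rX (all_submodels p) K
  ((1 + eta / 3) * p%:R) th s K0 th0 th1 s02)).
rewrite lee_fin KE norm_term//; apply: le_trans (ltW bound).
by rewrite /geometric /= mul1r lerD2l union_term_le.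
Qed.

End Asymptotics.

Theorem corollary6p1 (R : realType) (alpha : R) (alpha01 : 0 < alpha < 1) :
  (limn_esup (fun p : nat =>
     ereal_sup [set y : \bar R |
       exists (n : nat) (X : 'M[R]_(n, p)),
         [/\ (p <= n)%N, \rank X = p &
             y = (PoSI_const X (all_submodels p) alpha / Num.sqrt p%:R)%:E]])
   <= (Num.sqrt 3 / 2)%:E)%E.
Proof.
apply/lee_addgt0Pr => e e0; rewrite -EFinD.
set c := Num.sqrt 3 / 2 + e.
have sq3 : 0 <= Num.sqrt 3 :> R by exact: sqrtr_ge0.
have c0 : 0 < c by rewrite /c; lra.
(* The excess of [c ^ 2] over [(sqrt 3 / 2) ^ 2]. *)
pose eta := c ^+ 2 - 3 / 4.
have eta0 : 0 < eta.
  have : Num.sqrt 3 ^+ 2 = 3 :> R by rewrite sqr_sqrtr.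
  rewrite /eta /c; nra.
have cE : Num.sqrt (3 / 4 + eta) = c.
  by rewrite /eta addrC subrK sqrtr_sqr ger0_norm// ltW.
rewrite /limn_esup limf_esupE.
pose V := [set p | forall n (X : 'M[R]_(n, p)), \rank X = p ->
    PoSI_const X (all_submodels p) alpha <= c * Num.sqrt p%:R].
apply: (@le_trans _ _ (ereal_sup ((fun p : nat => ereal_sup [set y : \bar R |
       exists (n : nat) (X : 'M[R]_(n, p)),
         [/\ (p <= n)%N, \rank X = p &
             y = (PoSI_const X (all_submodels p) alpha / Num.sqrt p%:R)%:E]])
     @` V))).
  apply: ereal_inf_lbound; exists V => //.
  by have := PoSI_const_eventually _ _ alpha01 eta0; rewrite cE.
apply: ge_ereal_sup => _ [p Vp <-].
apply: ge_ereal_sup => _ [n [X [_ rX ->]]]; rewrite lee_fin.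
(* When [p = 0] the quotient is [0] by convention. *)
have [sp0|sp0] := eqVneq (Num.sqrt p%:R : R) 0.
  by rewrite sp0 invr0 mulr0 ltW.
by rewrite ler_pdivrMr ?lt_def ?sp0 ?sqrtr_ge0// Vp.
Qed.
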